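(* For all Noetherian spaces $X$ and $Y$, $||X + Y|| = ||X|| \oplus ||Y||$.
   Context: A topological space is Noetherian if every open subset is compact (every open cover has a finite subcover; no separation is required). $X+Y$ denotes the topological sum (coproduct, i.e. disjoint union) of $X$ and $Y$; it is Noetherian when $X$ and $Y$ are. $\oplus$ is the natural (Hessenberg) sum of ordinals. For a well-founded poset $P$ and $x \in P$, $\mathrm{rk}_P(x) = \sup_{x' < x} (\mathrm{rk}_P(x')+1)$ and the ordinal rank of $P$ is $|P| = \sup_{x \in P} (\mathrm{rk}_P(x)+1)$, where $\sup\emptyset = 0$. $\mathcal{H}_0 X$ is the poset of all closed subsets of $X$ (including $\emptyset$), ordered by inclusion; it is well-founded when $X$ is Noetherian. The stature of a Noetherian space $X$ is $||X|| = |\mathcal{H}_0 X| - 1$, equivalently $||X|| = \mathrm{rk}_{\mathcal{H}_0 X}(X)$. *)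

(* Defs.v *)
From HB Require Import structures.
From mathcomp Require Import all_boot all_order.
From mathcomp Require Import finmap boolp classical_sets.
From mathcomp Require Import topology_structure compact.
From Stdlib Require Setoid Morphisms Permutation.

Set Implicit Arguments.
Unset Strict Implicit.
Unset Printing Implicit Defensive.

Import Order.TTheory.

(* [olim f] denotes the least ordinal strictly above every [f i], that is,
   sup_i (f i + 1).  Different trees may denote the same ordinal: equality of
   ordinals is [oeq], not Leibniz equality. *)
Inductive ord : Type := olim (I : Type) (f : I -> ord).

Fixpoint ole (a b : ord) : Prop :=
  match a, b with @olim K f, @olim J g =>
    forall i, exists j, ole (f i) (g j)
  end.

Definition olt (a b : ord) : Prop :=
  match b with @olim J g => exists j, ole a (g j) end.

Definition oeq (a b : ord) : Prop := ole a b /\ ole b a.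

Declare Scope ord_scope.
Delimit Scope ord_scope with ord.
Bind Scope ord_scope with ord.
Notation "a <= b" := (ole a b) : ord_scope.
Notation "a < b" := (olt a b) : ord_scope.
Notation "a ≡ b" := (oeq a b) (at level 70, no associativity) : ord_scope.

Definition ozero : ord := olim (fun e : Empty_set => match e with end).

Definition osucc (a : ord) : ord := olim (fun _ : unit => a).

(* The natural (Hessenberg) sum, by the usual recursion: [a ⊕ b] is the least
   ordinal strictly above all [a' ⊕ b] with [a' < a] and all [a ⊕ b'] with
   [b' < b].  It is the sum of Cantor normal forms: see [hsum_CNF]. *)
Fixpoint hsum (a : ord) : ord -> ord :=
  match a with @olim K f =>
    fix hsum_a (b : ord) : ord :=
      match b with @olim J g =>
        olim (fun k : (K + J)%type =>
          match k with inl i => hsum (f i) b | inr j => hsum_a (g j) end)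
      end
  end.
Notation "a ⊕ b" := (hsum a b) (at level 50, left associativity) : ord_scope.

(* a + b = sup ({a' + 1 | a' < a} ∪ {(a + b') + 1 | b' < b}) *)
Fixpoint oadd (a b : ord) : ord :=
  match a, b with @olim K f, @olim J g =>
    olim (fun k : (K + J)%type =>
      match k with inl i => f i | inr j => oadd a (g j) end)
  end.
Notation "a + b" := (oadd a b) : ord_scope.

Fixpoint omuln (a : ord) (n : nat) : ord :=
  if n is m.+1 then oadd a (omuln a m) else ozero.

(* ω^b = sup ({0 + 1} ∪ {ω^b' * n + 1 | b' < b, n < ω}) *)
Fixpoint oexp (b : ord) : ord :=
  match b with @olim J g =>
    olim (fun k : option (J * nat) =>
      if k is Some (j, n) then omuln (oexp (g j)) n else ozero)
  end.

(* [s] lists the exponents e1 >= ... >= en of ω^e1 + ... + ω^en. *)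
Fixpoint cnf_val (s : seq ord) : ord :=
  if s is e :: t then oadd (oexp e) (cnf_val t) else ozero.

Fixpoint cnf (s : seq ord) : Prop :=
  if s is e :: t then (if t is e' :: _ then ole e' e else True) /\ cnf t
  else True.

Section OrdTheory.
Local Open Scope ord_scope.
Implicit Types a b c d e : ord.

Lemma ole_refl a : a <= a.
Proof. by elim: a => K f IH i; exists i; apply: IH. Qed.

Lemma ole_trans b a c : a <= b -> b <= c -> a <= c.
Proof.
elim: a b c => I f IH [J g] [K h] /= fg gh i.
have [j ij] := fg i; have [k jk] := gh j.
by exists k; apply: IH ij jk.
Qed.

#[global] Instance ole_preorder : RelationClasses.PreOrder ole.
Proof. by split=> [a|a b c]; [apply: ole_refl|apply: ole_trans]. Qed.

#[global] Instance ole_rewrite : RelationClasses.RewriteRelation ole := {}.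

#[global] Instance oeq_equiv : RelationClasses.Equivalence oeq.
Proof.
split=> [a|a b [ab ba]|a b c [ab ba] [bc cb]]; split=> //.
- exact: ole_refl.
- exact: ole_refl.
- exact: ole_trans ab bc.
- exact: ole_trans cb ba.
Qed.

Lemma olt_ole_trans b a c : a < b -> b <= c -> a < c.
Proof.
case: b c => J g [K h] /= [j aj] /(_ j)[k jk].
by exists k; apply: ole_trans aj jk.
Qed.

Lemma ole_olt_trans b a c : a <= b -> b < c -> a < c.
Proof.
by move=> ab; case: c => K h /= [k bk]; exists k; apply: ole_trans ab bk.
Qed.

Lemma olt_olim I (f : I -> ord) i : f i < olim f.
Proof. by exists i; apply: ole_refl. Qed.

Lemma ole_olim I (f : I -> ord) b : (forall i, f i < b) -> olim f <= b.
Proof. by case: b. Qed.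

Lemma oltW a b : a < b -> a <= b.
Proof.
elim: a b => I f IH [J g] [j aj] i; exists j.
by apply: IH; apply: (olt_ole_trans _ aj); apply: olt_olim.
Qed.

Lemma olt_trans b a c : a < b -> b < c -> a < c.
Proof. by move=> /oltW; apply: ole_olt_trans. Qed.

Lemma oleP a b : a <= b <-> (forall c, c < a -> c < b).
Proof.
split=> [ab c ca|]; first exact: olt_ole_trans ca ab.
by case: a b => I f [J g] H i; apply: (H (f i)); apply: olt_olim.
Qed.

Lemma ole_or_olt a b : a <= b \/ b < a.
Proof.
suff: (a <= b \/ b < a) /\ (b <= a \/ a < b) by case.
elim: a b => I f IHa; elim=> J g IHb; split.
- case: (pselect (forall i, f i < olim g)) => [|/existsNP[i fi]]; first by left.
  by right; exists i; have [_ []] := IHa i (olim g).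
- case: (pselect (forall j, g j < olim f)) => [|/existsNP[j gj]]; first by left.
  by right; exists j; have [[]] := IHb j.
Qed.

Lemma olt_wf : well_founded olt.
Proof.
suff H a b : b <= a -> Acc olt b by move=> a; apply: (H a); apply: ole_refl.
elim: a b => I f IH b ba; constructor=> c cb.
by have [i ci] := olt_ole_trans cb ba; apply: (IH i).
Qed.

Lemma olt_irr a : ~ a < a.
Proof. by elim/(well_founded_ind olt_wf): a => a IH aa; apply: (IH a). Qed.

Lemma olt_minimal (P : ord -> Prop) a :
  P a -> exists2 b, P b & forall c, P c -> b <= c.
Proof.
elim/(well_founded_ind olt_wf): a => a IH Pa.
case: (pselect (exists2 c, P c & c < a)) => [[c Pc ca]|H]; first exact: (IH c).
exists a => // c Pc; have [//|ca] := ole_or_olt a c.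
by case: H; exists c.
Qed.

Lemma ozero_le a : ozero <= a.
Proof. by case: a => I f []. Qed.

Lemma hsum_le a b a' b' : a <= a' -> b <= b' -> a ⊕ b <= a' ⊕ b'.
Proof.
elim: a b a' b' => I f IHa; elim=> J g IHb [I' f'] [J' g'] aa' bb' [i|j].
- by have [i' ii'] := aa' i; exists (inl i'); apply: IHa.
- by have [j' jj'] := bb' j; exists (inr j'); apply: (IHb j (olim f')).
Qed.

#[global] Instance hsum_ole :
  Morphisms.Proper
    (Morphisms.respectful ole (Morphisms.respectful ole ole)) hsum.
Proof. by move=> a a' aa' b b' bb'; apply: hsum_le. Qed.

Lemma hsum_ltl a a' b : a < a' -> a ⊕ b < a' ⊕ b.
Proof.
case: a' b => I f [J g] [i ai]; exists (inl i).
by apply: hsum_le ai _; apply: ole_refl.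
Qed.

Lemma hsum_ltr a b b' : b < b' -> a ⊕ b < a ⊕ b'.
Proof.
case: a b' => I f [J g] [j bj]; exists (inr j).
by apply: (@hsum_le (olim f) _ (olim f)) bj; apply: ole_refl.
Qed.

Lemma olt_hsum c a b : c < a ⊕ b ->
  (exists2 a', a' < a & c <= a' ⊕ b) \/ (exists2 b', b' < b & c <= a ⊕ b').
Proof.
case: a b => I f [J g] [[i|j] cij].
- by left; exists (f i) => //; apply: olt_olim.
- by right; exists (g j) => //; apply: olt_olim.
Qed.

Lemma hsumC a b : a ⊕ b <= b ⊕ a.
Proof.
elim: a b => I f IHa; elim=> J g IHb [i|j].
- by exists (inr i); apply: (IHa i (olim g)).
- by exists (inl j); apply: IHb.
Qed.

Lemma hsumAle a b c : (a ⊕ b) ⊕ c <= a ⊕ (b ⊕ c).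
Proof.
elim: a b c => I f IHa; elim=> J g IHb; elim=> K h IHc [[i|j]|k].
- by exists (inl i); apply: (IHa i (olim g) (olim h)).
- by exists (inr (inl j)); apply: (IHb j (olim h)).
- by exists (inr (inr k)); apply: IHc.
Qed.

Lemma hsumA a b c : (a ⊕ b) ⊕ c ≡ a ⊕ (b ⊕ c).
Proof.
split; first exact: hsumAle.
by rewrite hsumC (hsumC b c) hsumAle hsumC (hsumC b a); apply: ole_refl.
Qed.

Lemma hsum_gel a b : a <= a ⊕ b.
Proof. by elim: a b => I f IH [J g] i; exists (inl i); apply: IH. Qed.

Lemma hsum0_le a : ozero ⊕ a <= a.
Proof. by elim: a => I f IH [[]|i]; exists i; apply: IH. Qed.

Lemma oadd_le a b a' b' : a <= a' -> b <= b' -> a + b <= a' + b'.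
Proof.
elim: b a a' b' => J g IH [I f] [I' f'] [J' g'] aa' bb' [i|j].
- by have [i' ii'] := aa' i; exists (inl i').
- by have [j' jj'] := bb' j; exists (inr j'); apply: (IH j _ (olim f')).
Qed.

#[global] Instance oadd_ole :
  Morphisms.Proper
    (Morphisms.respectful ole (Morphisms.respectful ole ole)) oadd.
Proof. by move=> a a' aa' b b' bb'; apply: oadd_le. Qed.

Lemma oadd_ltr a b b' : b < b' -> a + b < a + b'.
Proof.
case: a b' => I f [J g] [j bj]; exists (inr j).
by apply: (@oadd_le (olim f)) bj; apply: ole_refl.
Qed.

Lemma oadd0 a : a + ozero <= a.
Proof. by case: a => I f [i|[]]; exists i; apply: ole_refl. Qed.

Lemma oadd_gel a b : a <= a + b.
Proof. by case: a b => I f [J g] i; exists (inl i); apply: ole_refl. Qed.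

Lemma ozero_oadd a : ozero + a <= a.
Proof. by elim: a => I f IH [[]|i]; exists i; apply: IH. Qed.

Lemma oadd_ger a b : b <= a + b.
Proof.
by elim: b a => J g IH [I f] j; exists (inr j); apply: (IH j (olim f)).
Qed.

Lemma oaddA a b c : (a + b) + c ≡ a + (b + c).
Proof.
split; elim: c a b => K h IH [I f] [J g].
- move=> [[i|j]|k]; [exists (inl i)|exists (inr (inl j))|exists (inr (inr k))].
  + exact: ole_refl.
  + exact: ole_refl.
  + exact: (IH k (olim f) (olim g)).
- move=> [i|[j|k]]; [exists (inl (inl i))|exists (inl (inr j))|exists (inr k)].
  + exact: ole_refl.
  + exact: ole_refl.
  + exact: (IH k (olim f) (olim g)).
Qed.

Lemma oadd_sub a b : a <= b -> exists c, b ≡ a + c.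
Proof.
move=> ab.
have [c bc cmin] := @olt_minimal (fun c => b <= a + c) b (oadd_ger a b).
exists c; split=> //; case: a c ab bc cmin => I f [J g] ab bc cmin.
apply: ole_olim => -[i|j].
  by apply: (olt_ole_trans _ ab); apply: olt_olim.
have [H|//] := ole_or_olt b (olim f + g j).
by case: (@olt_irr (g j)); apply: (olt_ole_trans _ (cmin _ H)); apply: olt_olim.
Qed.

Lemma oadd_le_hsum a b : a + b <= a ⊕ b.
Proof.
elim: b a => J g IH [I f] [i|j]; [exists (inl i)|exists (inr j)].
- exact: hsum_gel.
- exact: (IH j (olim f)).
Qed.

Lemma omuln_le a b n : a <= b -> omuln a n <= omuln b n.
Proof. by move=> ab; elim: n => [|n IH]; [apply: ole_refl|apply: oadd_le]. Qed.

Lemma omulnD a m n : omuln a m + omuln a n <= omuln a (m + n)%N.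
Proof.
elim: m => [|m IH] /=.
  by elim: (omuln a n) => J g IH [[]|j]; exists j; apply: IH.
by rewrite (proj1 (oaddA _ _ _)) IH; apply: ole_refl.
Qed.

Lemma oadd_sub_lt a b c n :
  ozero < b -> b <= omuln a n -> a + c <= b -> c < b.
Proof.
move=> b_gt0 ban acb; have [blec|//] := ole_or_olt b c; exfalso.
have absorb k : omuln a k + b <= b.
  elim: k => [|k IHk]; first exact: ozero_oadd.
  apply: ole_trans (proj1 (oaddA _ _ _)) (ole_trans _ acb).
  by apply: oadd_le (ole_trans IHk blec); apply: ole_refl.
apply: (@olt_irr b); apply: (olt_ole_trans _ (absorb n)).
exact: ole_olt_trans (ole_trans ban (oadd_gel _ ozero)) (oadd_ltr _ b_gt0).
Qed.

Lemma omuln_leq a m n : (m <= n)%N -> omuln a m <= omuln a n.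
Proof.
move=> /subnKC <-; rewrite -omulnD; exact: oadd_gel.
Qed.

Lemma oexp_le a b : a <= b -> oexp a <= oexp b.
Proof.
elim: a b => I f IH [J g] ab [[i n]|]; last by exists None; move=> [].
by have [j ij] := ab i; exists (Some (j, n)); apply: omuln_le; apply: IH.
Qed.

Lemma oexp_gt0 a : ozero < oexp a.
Proof. by case: a => I f; exists None; apply: ole_refl. Qed.

Lemma omuln_oexp_lt a b n : a < b -> omuln (oexp a) n < oexp b.
Proof.
case: b => J g [j aj]; exists (Some (j, n)).
by apply: omuln_le; apply: oexp_le.
Qed.

Lemma olt_oexp c a : c < oexp a ->
  c <= ozero \/ exists b n, b < a /\ c <= omuln (oexp b) n.
Proof.
case: a => I f [[[i n]|] ci]; [right|by left].
by exists (f i), n; split=> //; apply: olt_olim.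
Qed.

Lemma oexp_ge a : a <= oexp a.
Proof.
elim: a => I f IH i; exists (Some (i, 1%N)).
by apply: (ole_trans (IH i)); apply: (oadd_gel (oexp (f i)) ozero).
Qed.

(* ω^e is closed under ⊕, and ω^e ⊕ b = ω^e + b when b < ω^(e + 1). *)

Definition hsum_oexp_prop e :=
  forall b n, b <= omuln (oexp e) n -> oexp e ⊕ b <= oexp e + b.

Lemma hsum_omuln e m n : hsum_oexp_prop e ->
  omuln (oexp e) m ⊕ omuln (oexp e) n <= omuln (oexp e) (m + n).
Proof.
move=> He; elim: m => [|m IH] /=; first exact: hsum0_le.
rewrite oadd_le_hsum (proj1 (hsumA _ _ _)) IH.
by apply: (He _ (m + n)%N); apply: ole_refl.
Qed.

Lemma oexp_principal e a b : (forall e', e' < e -> hsum_oexp_prop e') ->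
  a < oexp e -> b < oexp e -> a ⊕ b < oexp e.
Proof.
move=> He ae be; have [a0|[e1 [m [e1e am]]]] := olt_oexp ae.
  apply: (ole_olt_trans _ be); rewrite a0; exact: hsum0_le.
have [b0|[e2 [n [e2e bn]]]] := olt_oexp be.
  by apply: (ole_olt_trans _ ae); rewrite b0 hsumC; apply: hsum0_le.
have [e3 e3e [e13 e23]] : exists2 e3, e3 < e & e1 <= e3 /\ e2 <= e3.
  have [e12|/oltW e21] := ole_or_olt e1 e2; [exists e2 | exists e1] => //.
    by split=> //; apply: ole_refl.
  by split=> //; apply: ole_refl.
apply: (ole_olt_trans _ (omuln_oexp_lt (m + n) e3e)).
apply: (ole_trans _ (hsum_omuln m n (He _ e3e))).
by apply: hsum_le; [apply: ole_trans am _|apply: ole_trans bn _];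
  apply: omuln_le; apply: oexp_le.
Qed.

Lemma hsum_oexp e : hsum_oexp_prop e.
Proof.
elim/(well_founded_ind olt_wf): e => e IHe b n.
elim/(well_founded_ind olt_wf): b => b IHb bn.
have IHle c : c < b -> oexp e ⊕ c <= oexp e + c.
  by move=> cb; apply: IHb => //; apply: ole_trans (oltW cb) bn.
have {}IHb c : c < b -> oexp e ⊕ c < oexp e + b.
  by move=> cb; apply: ole_olt_trans (IHle _ cb) (oadd_ltr _ cb).
apply/oleP => c /olt_hsum[[a ae ca]|[b' b'b cb']]; last first.
  exact: ole_olt_trans cb' (IHb _ b'b).
apply: ole_olt_trans ca _; have [eb|be] := ole_or_olt (oexp e) b; last first.
  apply: (olt_ole_trans _ (oadd_gel _ _)); exact: oexp_principal IHe ae be.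
have [d [bd db]] := oadd_sub eb.
have ltdb : d < b.
  exact: oadd_sub_lt (olt_ole_trans (oexp_gt0 e) eb) bn db.
have edb : oexp e ⊕ d <= b by apply: ole_trans (IHle _ ltdb) db.
have bed : b <= oexp e ⊕ d by apply: ole_trans bd (oadd_le_hsum _ _).
apply: (@ole_olt_trans (oexp e ⊕ (a ⊕ d))).
  apply: ole_trans (hsum_le (ole_refl _) bed) _.
  apply: ole_trans (proj2 (hsumA _ _ _)) _.
  exact: ole_trans (hsum_le (hsumC _ _) (ole_refl _)) (hsumAle _ _ _).
by apply: IHb; apply: olt_ole_trans (hsum_ltl _ ae) edb.
Qed.

Lemma cnf_val_le e s : cnf (e :: s) ->
  cnf_val (e :: s) <= omuln (oexp e) (size s).+1.
Proof.
elim: s e => [|e' s IH] e; first by move=> _; apply: ole_refl.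
move=> [e'e cs]; apply: oadd_le; first exact: ole_refl.
by apply: ole_trans (IH _ cs) _; apply: omuln_le; apply: oexp_le.
Qed.

Fixpoint hcnf (s : seq ord) : ord :=
  if s is e :: t then oexp e ⊕ hcnf t else ozero.

Lemma cnf_val_hsum s : cnf s -> cnf_val s ≡ hcnf s.
Proof.
elim: s => [|e s IH] cs; first by split; apply: ole_refl.
have [le_s ge_s] := IH (proj2 cs); split.
  apply: ole_trans (oadd_le_hsum _ _) _.
  by apply: hsum_le => //; apply: ole_refl.
apply: ole_trans (hsum_le (ole_refl _) ge_s) _.
case: s cs {IH le_s ge_s} => [|e' s] cs.
  exact: (@hsum_oexp e ozero 0 (ozero_le _)).
apply: (@hsum_oexp e _ (size s).+1); apply: ole_trans (cnf_val_le (proj2 cs)) _.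
by apply: omuln_le; apply: oexp_le; case: cs.
Qed.

Lemma hcnf_cat s t : hcnf (s ++ t) ≡ hcnf s ⊕ hcnf t.
Proof.
elim: s => [|e s [IH1 IH2]] /=.
  split; last exact: hsum0_le.
  by apply: ole_trans (hsum_gel _ ozero) (hsumC _ _).
split.
  apply: (ole_trans _ (proj2 (hsumA _ _ _))); apply: hsum_le IH1; exact: ole_refl.
apply: ole_trans (proj1 (hsumA _ _ _)) _; apply: hsum_le IH2; exact: ole_refl.
Qed.

Lemma hcnf_perm s t : Permutation.Permutation s t -> hcnf s <= hcnf t.
Proof.
elim=> {s t} [|e s t _ IH|e e' s|s t u _ IHs _ IHt].
- exact: ole_refl.
- by apply: hsum_le IH; apply: ole_refl.
- apply: ole_trans (proj2 (hsumA _ _ _)) _.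
  apply: ole_trans (hsum_le (hsumC _ _) (ole_refl _)) _; exact: hsumAle.
- exact: ole_trans IHs IHt.
Qed.

(* To add ordinals naturally, merge the terms of their Cantor normal forms. *)
Theorem hsum_CNF s t u : cnf s -> cnf t -> cnf u ->
  Permutation.Permutation (s ++ t) u -> cnf_val s ⊕ cnf_val t ≡ cnf_val u.
Proof.
move=> cs ct cu stu.
have [s1 s2] := cnf_val_hsum cs; have [t1 t2] := cnf_val_hsum ct.
have [u1 u2] := cnf_val_hsum cu; have [st1 st2] := hcnf_cat s t.
split.
  apply: ole_trans (hsum_le s1 t1) (ole_trans st2 _).
  exact: ole_trans (hcnf_perm stu) u2.
apply: (ole_trans _ (hsum_le s2 t2)); apply: (ole_trans _ st1).
by apply: ole_trans u1 (hcnf_perm _); apply: Permutation.Permutation_sym.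
Qed.

Theorem cnf_ex a : exists2 s, cnf s & a ≡ cnf_val s.
Proof.
elim/(well_founded_ind olt_wf): a => a IH.
have [a0|a_gt0] := ole_or_olt a ozero.
  by exists [::] => //; split=> //; apply: ozero_le.
have [e' ae' e'min] : exists2 e', a < oexp e' & forall e, a < oexp e -> e' <= e.
  apply: (@olt_minimal _ (osucc a)).
  apply: ole_olt_trans (omuln_oexp_lt 1 (olt_olim (fun _ : unit => a) tt)).
  exact: ole_trans (oexp_ge a) (oadd_gel _ ozero).
have [a0|[e [n [ltee' an]]]] := olt_oexp ae'.
  by case: (@olt_irr a); apply: ole_olt_trans a0 a_gt0.
have ea : oexp e <= a.
  have [//|ae] := ole_or_olt (oexp e) a.
  by case: (@olt_irr e); apply: olt_ole_trans ltee' (e'min _ ae).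
have [c [ac ca]] := oadd_sub ea.
have ltca : c < a by exact: oadd_sub_lt a_gt0 an ca.
have [s cs [sc1 sc2]] := IH c ltca; exists (e :: s).
  split=> //; case: s cs sc1 sc2 => // e2 s cs _ sc2.
  have [//|ee2] := ole_or_olt e2 e; case: (@olt_irr a).
  apply: ole_olt_trans an (olt_trans _ ltca).
  apply: olt_ole_trans (omuln_oexp_lt n ee2) _.
  exact: ole_trans (oadd_gel _ _) sc2.
split; first by apply: ole_trans ac (oadd_le (ole_refl _) sc1).
exact: ole_trans (oadd_le (ole_refl _) sc2) ca.
Qed.

End OrdTheory.

Section Rank.
Context {d : Order.disp_t} {P : porderType d}.
Context (P_wf : well_founded (fun x y : P => (x < y)%O)).

Definition rk : P -> ord :=
  Fix P_wf (fun=> ord) (fun x rk_lt =>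
    olim (fun y : {y : P | (y < x)%O} => rk_lt (sval y) (svalP y))).

Definition ordinal_rank : ord := olim rk.

Lemma rkE (x : P) : rk x = olim (fun y : {y : P | (y < x)%O} => rk (sval y)).
Proof.
rewrite /rk Fix_eq// => y f g fg; congr olim.
by apply/funext => z; apply: fg.
Qed.

End Rank.

Local Open Scope classical_set_scope.

(* [cover_compact] rather than [compact]: the library identifies them for
   pointed spaces only, and a Noetherian space may be empty. *)
HB.mixin Record isNoetherian T & Topological T := {
  open_cover_compact : forall U : set T, open U -> cover_compact U
}.

#[short(type="noetherianType")]
HB.structure Definition Noetherian := {T of Topological T & isNoetherian T}.

Section SumTopology.
Context {X Y : topologicalType}.

Definition sum_open : set_system (X + Y) :=
  [set U | open (inl @^-1` U) /\ open (inr @^-1` U)].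

Let sum_openT : sum_open setT.
Proof. by split; rewrite preimage_setT; apply: openT. Qed.

Let sum_openI : setI_closed sum_open.
Proof. by move=> U V [U1 U2] [V1 V2]; split; apply: openI. Qed.

Let sum_open_bigU (I : Type) (f : I -> set (X + Y)) :
  (forall i, sum_open (f i)) -> sum_open (\bigcup_i f i).
Proof.
by move=> fo; split; rewrite preimage_bigcup; apply: bigcup_open => i _;
  case: (fo i).
Qed.

HB.instance Definition _ := isOpenTopological.Build (X + Y)%type
  sum_openT sum_openI sum_open_bigU.

Lemma sum_openE (U : set (X + Y)) :
  open U = (open (inl @^-1` U) /\ open (inr @^-1` U)).
Proof. by []. Qed.

End SumTopology.

Section SumNoetherian.
Context {X Y : noetherianType}.

Let sum_noetherian (U : set (X + Y)) : open U -> cover_compact U.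
Proof.
move=> [Ul Ur] I D f fo Uf.
have [i iD|x Ux|E ED UE] :=
  @open_cover_compact X _ Ul I D (fun i => inl @^-1` f i).
- by case: (fo _ iD).
- exact: Uf.
have [i iD|x Ux|F FD UF] :=
  @open_cover_compact Y _ Ur I D (fun i => inr @^-1` f i).
- by case: (fo _ iD).
- exact: Uf.
exists (E `|` F)%fset => [i|[x|x] Ux].
- by rewrite in_fsetU => /orP[/ED|/FD].
- have [i iE xi] := UE x Ux; exists i => //=.
  by rewrite in_fsetU; apply/orP; left.
- have [i iF xi] := UF x Ux; exists i => //=.
  by rewrite in_fsetU; apply/orP; right.
Qed.

HB.instance Definition _ := isNoetherian.Build (X + Y)%type sum_noetherian.

End SumNoetherian.

Definition closed_sets (X : topologicalType) := {C : set X | `[< closed C >]}.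

HB.instance Definition _ (X : topologicalType) := SubChoice.on (closed_sets X).
HB.instance Definition _ (X : topologicalType) :=
  [SubChoice_isSubPOrder of closed_sets X by <: with set_display].

Definition closed_setT (X : topologicalType) : closed_sets X :=
  exist _ setT (asboolT closedT).

Lemma closed_sets_leE (X : topologicalType) (C D : closed_sets X) :
  (C <= D)%O = `[< val C `<=` val D >].
Proof. by []. Qed.

Lemma closed_sets_wf (X : noetherianType) :
  well_founded (fun C D : closed_sets X => (C < D)%O).
Proof.
move=> C0; apply: contrapT => C0nacc.
pose bad := {C : closed_sets X | ~ Acc (fun C D => (C < D)%O) C}.
have step (C : bad) : {D : bad | (sval D < sval C)%O}.
  apply: cid; case: C => C /= Cnacc; apply: contrapT => noD; apply: Cnacc.
  constructor=> D DC; apply: contrapT => Dnacc.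
  by apply: noD; exists (exist _ D Dnacc).
pose C_ n : closed_sets X :=
  sval (iter n (fun C => sval (step C)) (exist _ C0 C0nacc : bad)).
have C_lt n : (C_ n.+1 < C_ n)%O by exact: svalP (step _).
have C_le m n : (m <= n)%N -> val (C_ n) `<=` val (C_ m).
  move=> mn; apply/asboolP; rewrite -closed_sets_leE.
  by elim: n mn => [|n IH]; rewrite leq_eqVlt => /predU1P[->//|//];
    rewrite ltnS => /IH; apply: le_trans (ltW (C_lt n)).
have Co n : open (~` val (C_ n)).
  by apply: closed_openC; apply/asboolP; case: (C_ n).
have [|i _|//|E _ EU] := @open_cover_compact X (\bigcup_n ~` val (C_ n)) _ _
  setT (fun n => ~` val (C_ n)).
- exact: bigcup_open.
- exact: Co.
pose N := \max_(i <- E) i.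
suff: (C_ N <= C_ N.+1)%O by move=> /(lt_le_trans (C_lt N)); rewrite ltxx.
rewrite closed_sets_leE; apply/asboolP => x xN; apply: contrapT => xN1.
have [n /= nE xn] := EU x (ex_intro2 _ _ N.+1 I xN1).
by apply: xn; apply: C_le xN; apply: leq_bigmax_seq.
Qed.

Definition stature (X : noetherianType) : ord :=
  rk (@closed_sets_wf X) (closed_setT X).

(* That is, [stature X] is |H_0 X| - 1. *)
Lemma osucc_stature (X : noetherianType) :
  (osucc (stature X) ≡ ordinal_rank (@closed_sets_wf X))%ord.
Proof.
split=> [_|C]; first by exists (closed_setT X); apply: ole_refl.
exists tt; change (rk (@closed_sets_wf X) C <= stature X)%ord.
have : (C <= closed_setT X)%O by rewrite closed_sets_leE; apply/asboolP.
rewrite le_eqVlt => /predU1P[->|Clt]; first exact: ole_refl.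
rewrite /stature [rk _ (closed_setT X)]rkE; apply: oltW.
exact: (olt_olim _ (exist _ C Clt)).
Qed.

(* Main.v *)
From mathcomp Require Import all_boot all_order.
From mathcomp Require Import boolp classical_sets topology_structure.
Require Import Defs.

(** A closed subset of X + Y is the disjoint union of a closed subset of X and
    a closed subset of Y, and inclusion is tested on each side separately.
    So the poset of closed subsets of X + Y is the product of those of X and Y,
    and the statement is a fact about ranks in a product of well-founded posets
    ([rk_product]): the rank of a pair is the natural sum of the ranks of its
    components.  The natural sum is the least operation that strictly increases
    in each argument, while the rank in a product is the least function that
    strictly increases along the product order; each of these two minimalities
    gives one of the two inequalities.  The stature is the rank of the whole
    space, which is the pair of the two whole spaces. *)

Set Implicit Arguments.
Unset Strict Implicit.
Unset Printing Implicit Defensive.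

Import Order.TTheory.

Section RankTheory.
Context {d : Order.disp_t} {P : porderType d}.
Context (P_wf : well_founded (fun x y : P => (x < y)%O)).

Lemma rk_lt (x y : P) : (x < y)%O -> (rk P_wf x < rk P_wf y)%ord.
Proof. by move=> xy; rewrite (rkE _ y); apply: (olt_olim _ (exist _ x xy)). Qed.

Lemma rk_le (x y : P) : (x <= y)%O -> (rk P_wf x <= rk P_wf y)%ord.
Proof.
by rewrite le_eqVlt => /predU1P[->|/rk_lt/oltW//]; apply: ole_refl.
Qed.

Lemma olt_rk (a : ord) (y : P) : (a < rk P_wf y)%ord ->
  exists2 x, (x < y)%O & (a <= rk P_wf x)%ord.
Proof. by rewrite rkE => -[[x xy] ax]; exists x. Qed.

Lemma rk_le_ub (y : P) (a : ord) :
  (forall x, (x < y)%O -> (rk P_wf x < a)%ord) -> (rk P_wf y <= a)%ord.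
Proof. by move=> H; rewrite rkE; apply: ole_olim => -[x xy]; apply: H. Qed.

End RankTheory.

Section RankProduct.
Context {dP dQ dR : Order.disp_t}.
Context {P : porderType dP} {Q : porderType dQ} {R : porderType dR}.
Context (P_wf : well_founded (fun x y : P => (x < y)%O)).
Context (Q_wf : well_founded (fun x y : Q => (x < y)%O)).
Context (R_wf : well_founded (fun x y : R => (x < y)%O)).
Context (pr : P -> Q -> R).
Context (pr_le : forall p q p' q',
  (pr p q <= pr p' q')%O = (p <= p')%O && (q <= q')%O).
Context (pr_surj : forall r, exists p q, r = pr p q).

Lemma pr_lt p q p' q' :
  (pr p q < pr p' q')%O =
    (p < p')%O && (q <= q')%O || (p <= p')%O && (q < q')%O.
Proof.
rewrite !lt_leAnge !pr_le.
by case: (p <= p')%O; case: (q <= q')%O; case: (p' <= p)%O; case: (q' <= q)%O.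
Qed.

(** The natural sum of the ranks strictly increases on the product, and the rank
    is the least ordinal function that does. *)
Lemma rk_product_le p q : (rk R_wf (pr p q) <= rk P_wf p ⊕ rk Q_wf q)%ord.
Proof.
move: {2}(pr p q) (erefl (pr p q)) => r.
elim/(well_founded_ind R_wf): r p q => r IH p q rE; apply: rk_le_ub => r'.
have [p' [q' ->]] := pr_surj r' => lt_pq.
apply: ole_olt_trans; first by apply: IH (erefl _); rewrite -rE.
move: lt_pq; rewrite pr_lt => /orP[]/andP[pp' qq'].
- by apply: olt_ole_trans (hsum_ltl _ (rk_lt P_wf pp')) _;
    apply: hsum_le (ole_refl _) (rk_le Q_wf qq').
- by apply: ole_olt_trans (hsum_ltr _ (rk_lt Q_wf qq'));
    apply: hsum_le (rk_le P_wf pp') (ole_refl _).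
Qed.

(** An ordinal below a natural sum is bounded by a sum with one argument
    decreased; an ordinal below the rank of p is in turn bounded by the rank of
    some p' < p, so it suffices to decrease one component of the pair. *)
Lemma rk_product_ge p q : (rk P_wf p ⊕ rk Q_wf q <= rk R_wf (pr p q))%ord.
Proof.
move: {2}(pr p q) (erefl (pr p q)) => r.
elim/(well_founded_ind R_wf): r p q => r IH p q rE.
apply/oleP => c /olt_hsum[[a /olt_rk[p' p'p ap'] ca]|[b /olt_rk[q' q'q bq'] cb]].
- have lt_r : (pr p' q < pr p q)%O by rewrite pr_lt p'p lexx.
  apply: ole_olt_trans (rk_lt R_wf lt_r).
  apply: ole_trans ca (ole_trans (hsum_le ap' (ole_refl _)) _).
  by apply: IH (erefl _); rewrite -rE.
- have lt_r : (pr p q' < pr p q)%O by rewrite pr_lt q'q lexx orbT.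
  apply: ole_olt_trans (rk_lt R_wf lt_r).
  apply: ole_trans cb (ole_trans (hsum_le (ole_refl _) bq') _).
  by apply: IH (erefl _); rewrite -rE.
Qed.

(** The two assumptions on [pr] say that it identifies R with the product of P
    and Q under the componentwise order. *)
Lemma rk_product p q : (rk R_wf (pr p q) ≡ rk P_wf p ⊕ rk Q_wf q)%ord.
Proof. by split; [apply: rk_product_le|apply: rk_product_ge]. Qed.

End RankProduct.

Local Open Scope classical_set_scope.

Section ClosedSum.
Context {X Y : topologicalType}.

Definition sum_set (A : set X) (B : set Y) : set (X + Y) :=
  [set z | match z with inl x => A x | inr y => B y end].

Lemma closed_sum_set (A : set X) (B : set Y) :
  closed A -> closed B -> closed (sum_set A B).
Proof. by rewrite -!openC => Ao Bo; rewrite sum_openE; split. Qed.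

Definition closed_sum (C : closed_sets X) (D : closed_sets Y) :
    closed_sets (X + Y)%type :=
  exist _ (sum_set (val C) (val D))
    (asboolT (closed_sum_set (asboolW (valP C)) (asboolW (valP D)))).

Lemma closed_sum_le C D C' D' :
  (closed_sum C D <= closed_sum C' D')%O = (C <= C')%O && (D <= D')%O.
Proof.
rewrite !closed_sets_leE -asbool_and; apply: asbool_equiv_eq; split.
- by move=> CD; split=> [x|y]; [apply: (CD (inl x))|apply: (CD (inr y))].
- by move=> [CC' DD'] [x|y]; [apply: CC'|apply: DD'].
Qed.

Lemma closed_sum_surj (E : closed_sets (X + Y)%type) :
  exists C D, E = closed_sum C D.
Proof.
have /asboolP := valP E; rewrite -openC sum_openE => -[El Er].
have {}El : closed (inl @^-1` val E : set X) by rewrite -openC.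
have {}Er : closed (inr @^-1` val E : set Y) by rewrite -openC.
exists (exist _ (inl @^-1` val E) (asboolT El)).
exists (exist _ (inr @^-1` val E) (asboolT Er)).
by apply: val_inj; apply/seteqP; split=> -[].
Qed.

Lemma closed_setT_sum :
  closed_setT (X + Y)%type = closed_sum (closed_setT X) (closed_setT Y).
Proof. by apply: val_inj; apply/seteqP; split=> -[]. Qed.

End ClosedSum.

Theorem proposition8p2 (X Y : noetherianType) :
  (stature (X + Y)%type ≡ stature X ⊕ stature Y)%ord.
Proof.
rewrite /stature closed_setT_sum.
exact: rk_product closed_sum_le closed_sum_surj _ _.
Qed.
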